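(* Let $X,Y$ be metric spaces and $f:X\to Y$ a rough isometry. Then $d_\infty(X)=d_\infty(Y)$.
   Context: For a metric space $(X,\delta_X)$, $B_X(x,R)$ is the open ball of centre $x$ and radius $R$, and for $\Omega\subset X$, $n_r(\Omega)$ is the least number of open balls of radius $r$ which cover $\Omega$ (possibly $\infty$). The asymptotic dimension of $X$ is $$d_\infty(X):=\lim_{r\to\infty}\limsup_{R\to\infty}\frac{\log n_r(B_X(x,R))}{\log R},$$ which does not depend on $x\in X$. A map $f:X\to Y$ is a rough isometry if there are $a\ge1$, $b,\varepsilon\ge0$ such that (i) $a^{-1}\delta_X(x_1,x_2)-b\le\delta_Y(f(x_1),f(x_2))\le a\,\delta_X(x_1,x_2)+b$ for all $x_1,x_2\in X$, and (ii) $\bigcup_{x\in X}B_Y(f(x),\varepsilon)=Y$. *)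

(* Defs.v *)
From mathcomp Require Import all_boot all_order all_algebra.
From mathcomp Require Import all_classical all_reals all_analysis.

Set Implicit Arguments.
Unset Strict Implicit.
Unset Printing Implicit Defensive.

Import Order.TTheory GRing.Theory Num.Theory.
Import numFieldNormedType.Exports.

Local Open Scope classical_set_scope.
Local Open Scope ring_scope.

Section AsymptoticDimension.
Context {R : realType} {X : metricType R}.

(* The centres of the balls range over the whole space, not only over Omega. *)
Definition covered_by_balls (r : R) (Omega : set X) (n : nat) : Prop :=
  exists c : 'I_n -> X, Omega `<=` \bigcup_(i in [set: 'I_n]) ball (c i) r.

(* ereal_inf set0 = +oo: the value when no finite cover exists. *)
Definition covering_number (r : R) (Omega : set X) : \bar R :=
  ereal_inf [set n%:R%:E | n in [set n : nat | covered_by_balls r Omega n]].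

Definition growth_exponent (x : X) (r : R) : \bar R :=
  limf_esup
    (fun rho : R => lne (covering_number r (ball x rho)) * ((ln rho)^-1)%:E)%E
    (pinfty_nbhs R).

(* The value does not depend on x; the base point is kept as an argument so
   that no point of X has to be chosen. *)
Definition asymptotic_dimension (x : X) : \bar R :=
  lim (growth_exponent x r @[r --> +oo]).

Lemma covering_number_ge0 (r : R) (Omega : set X) :
  (0 <= covering_number r Omega)%E.
Proof. by apply: le_ereal_inf_tmp => _ [n _ <-]; rewrite lee_fin ler0n. Qed.

Lemma covering_number_nincr (Omega : set X) (r s : R) :
  r <= s -> (covering_number s Omega <= covering_number r Omega)%E.
Proof.
move=> rs; apply: ereal_inf_le_tmp => _ [n [c Oc] <-]; exists n => //.
exists c => y /Oc [i _ yi]; exists i => //; exact: le_ball yi.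
Qed.

Lemma growth_exponent_nincr (x : X) (r s : R) :
  r <= s -> (growth_exponent x s <= growth_exponent x r)%E.
Proof.
move=> rs; apply: le_ereal_inf_tmp => _ [V FV <-].
pose W := V `&` [set rho : R | 1 < rho].
have FW : pinfty_nbhs R W by apply: filterI => //; exact: nbhs_pinfty_gt.
apply: (@le_trans _ _ (ereal_sup
    [set (lne (covering_number s (ball x rho)) * ((ln rho)^-1)%:E)%E
       | rho in W])).
  by apply: ereal_inf_lbound; exists W.
apply: ge_ereal_sup => _ [rho [Vrho rho1] <-].
apply: le_trans (ereal_sup_ubound _); last by exists rho.
apply: lee_wpmul2r; first by rewrite lee_fin invr_ge0 ltW// ln_gt0.
by rewrite lee_lne ?in_itv/= ?covering_number_ge0 ?leey// covering_number_nincr.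
Qed.

(* The limit over r exists, so lim never takes its default value. *)
Lemma is_cvg_growth_exponent (x : X) :
  cvg (growth_exponent x r @[r --> +oo]).
Proof.
apply/cvg_ex; eexists.
apply: (@nonincreasing_cvge _ (growth_exponent x)).
exact: growth_exponent_nincr.
Qed.

End AsymptoticDimension.

Definition rough_isometry {R : realType} {X Y : metricType R} (f : X -> Y) :
    Prop :=
  exists a b eps : R,
    [/\ 1 <= a, 0 <= b, 0 <= eps,
        forall x1 x2 : X,
          a^-1 * mdist x1 x2 - b <= mdist (f x1) (f x2) <= a * mdist x1 x2 + b
      & \bigcup_(x in [set: X]) ball (f x) eps = [set: Y]].

(* Main.v *)
(* The map g : Y -> X, be it a rough isometry or a quasi-inverse of one, sends
   the ball of radius rho about y into the ball of radius a rho + C about x, and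
   preimages of balls of radius r lie in balls of radius 2 a r + b.  The covering
   number of the former ball is thus at most that of the latter, and the affine
   change of the radius rho is invisible to log rho at infinity.  Letting r tend
   to infinity gives dim Y <= dim X. *)

Require Import Defs.
From mathcomp Require Import all_boot all_order all_algebra.
From mathcomp Require Import all_classical all_reals all_analysis.
From mathcomp Require Import lra.

Import Order.TTheory GRing.Theory Num.Theory.
Import numFieldNormedType.Exports.

Local Open Scope classical_set_scope.
Local Open Scope ring_scope.

(** For large [rho], [ln (a * rho + C) <= ln (a + 1) + ln rho], and the constant [ln (a + 1)]
    vanishes after division by [ln rho]. *)
Lemma limf_esup_lne_affine (R : realType) (M N : R -> \bar R) (a C : R) :
  1 <= a ->
  (forall rho, 0 < rho -> (1 <= N rho)%E) ->
  (forall rho, 0 <= M rho <= N (a * rho + C)%R)%E ->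
  (limf_esup (fun rho => lne (M rho) * ((ln rho)^-1)%:E) (pinfty_nbhs R) <=
   limf_esup (fun rho => lne (N rho) * ((ln rho)^-1)%:E) (pinfty_nbhs R))%E.
Proof.
move=> a1 N1 MN; apply: le_ereal_inf_tmp => _ [V FV <-].
set S := ereal_sup _.
have SV rho : V rho -> (lne (N rho) * ((ln rho)^-1)%:E <= S)%E.
  by move=> Vrho; apply: ereal_sup_ubound; exists rho.
have [A [_ AV]] := FV.
(* This excludes [S = -oo], and in the finite case it allows the bound on [ln (a * rho + C)] to be
   multiplied by [k]. *)
have S0 : (0 <= S)%E.
  pose r0 := Num.max A 1 + 1.
  have [Ar0 r01] : A < r0 /\ 1 < r0.
    by split; apply: (@le_lt_trans _ _ (Num.max A 1));
      rewrite ?ltrDl// le_max lexx ?orbT.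
  apply: le_trans (SV r0 (AV _ Ar0)); apply: mule_ge0.
    by rewrite lne_ge0 N1// (lt_trans _ r01).
  by rewrite lee_fin invr_ge0 ln_ge0// ltW.
move: S S0 SV => [k| |] // k0 SV; last by rewrite leey.
rewrite lee_fin in k0; apply/lee_addgt0Pr => e e0.
(* ln rho >= ln B makes the error term k ln (a + 1) at most e ln rho. *)
pose B := expR (k * ln (a + 1) / e).
(* Beyond [1], [ln rho] is positive; beyond [C], [a * rho + C <= (a + 1) * rho]; beyond [A - C] and
   [1 - C], since [rho <= a * rho], the point [a * rho + C] lies in [V] and has positive
   logarithm. *)
pose D := \big[Num.max/0]_(z <- [:: 1; C; A - C; 1 - C; B]) z.
have lnM1 rho : D < rho ->
    (lne (M rho) * ((ln rho)^-1)%:E <= (k + e)%:E)%E.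
  rewrite /D unlock /= !gt_max => /and5P[rho1 rhoC rhoA rho1C /andP[rhoB _]].
  have rho0 : 0 < rho by lra.
  have arho : rho <= a * rho by rewrite ler_peMl// ltW.
  have R1 : 1 < a * rho + C by lra.
  have lnrho : 0 < ln rho by rewrite ln_gt0.
  have lnR : 0 < ln (a * rho + C) by rewrite ln_gt0.
  have a10 : 0 < a + 1 by lra.
  have /SV : V (a * rho + C) by apply: AV; lra.
  rewrite lee_pdivrMr// => NR; rewrite lee_pdivrMr//.
  have /andP[M0 MNr] := MN rho.
  apply: (@le_trans _ _ (lne (N (a * rho + C)))).
    by rewrite lee_lne ?in_itv/= ?M0 ?leey// (le_trans M0 MNr).
  apply: (le_trans NR); rewrite -!EFinM lee_fin.
  have lnRle : ln (a * rho + C) <= ln (a + 1) + ln rho.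
    by rewrite -lnM ?posrE// ler_ln ?posrE ?mulr_gt0//; lra.
  have : k * ln (a + 1) <= e * ln rho.
    rewrite -ler_pdivrMl// mulrC -[leLHS]expRK ler_ln ?posrE ?expR_gt0//.
    exact: ltW.
  have := ler_wpM2l k0 lnRle; lra.
apply: (@le_trans _ _ (ereal_sup [set
    (lne (M rho) * ((ln rho)^-1)%:E)%E | rho in [set rho | D < rho]])).
  apply: ereal_inf_lbound; exists [set rho | D < rho] => //.
  exact: nbhs_pinfty_gt (num_real D).
by apply: ge_ereal_sup => _ [rho Drho <-]; rewrite -EFinD lnM1.
Qed.

Lemma covering_number_ge1 (R : realType) (X : metricType R) (x : X) (r rho : R) :
  0 < rho -> (1 <= covering_number r (ball x rho))%E.
Proof.
move=> rho0; apply: le_ereal_inf_tmp => _ [[|n] [c xc] <-].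
  by have [[]] : (\bigcup_(i in [set: 'I_0]) ball (c i) r) x
    by apply: xc; exact: ballxx.
by rewrite lee_fin ler1n.
Qed.

(** Two points that [g] sends into one ball of radius [r] have images less than [2 * r] apart, so
    any point of the preimage can serve as the new centre. *)
Lemma covering_number_preimage (R : realType) (X Y : metricType R) (g : Y -> X)
    (a b r : R) (A : set Y) (Omega : set X) (y : Y) :
  0 < a ->
  (forall y1 y2, mdist y1 y2 <= a * mdist (g y1) (g y2) + b) ->
  A `<=` g @^-1` Omega ->
  (covering_number (2 * a * r + b) A <= covering_number r Omega)%E.
Proof.
move=> a0 gdist AO; apply: ereal_inf_le_tmp => _ [n [c Oc] <-]; exists n => //.
(* The default [y] occurs only for an empty preimage, which contains no point of [A]. *)
exists (fun i => xget y (g @^-1` ball (c i) r)) => z Az.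
have [i _ ciz] := Oc _ (AO _ Az); exists i => //.
have := @xgetI _ y (g @^-1` ball (c i) r) z ciz.
set w := xget _ _; rewrite /= ballEmdist/= => ciw.
move: ciz; rewrite !ballEmdist/= => ciz.
apply: (le_lt_trans (gdist _ _)); rewrite ltrD2r [2 * a]mulrC -mulrA ltr_pM2l//.
have := metric_triangle (g w) (c i) (g z).
rewrite (metric_sym (g w) (c i)); lra.
Qed.

(** With an infimum in place of the limit, comparing dimensions takes just one suitable radius in
    [Y] for each [r] in [X]. *)
Lemma asymptotic_dimensionE (R : realType) (X : metricType R) (x : X) :
  asymptotic_dimension x = ereal_inf (range (growth_exponent x)).
Proof.
by apply/cvg_lim => //; apply: nonincreasing_cvge; exact: growth_exponent_nincr.
Qed.

Lemma asymptotic_dimension_le (R : realType) (X Y : metricType R) (g : Y -> X)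
    (a b : R) (x : X) (y : Y) :
  1 <= a ->
  (forall y1 y2, mdist (g y1) (g y2) <= a * mdist y1 y2 + b) ->
  (forall y1 y2, mdist y1 y2 <= a * mdist (g y1) (g y2) + b) ->
  (asymptotic_dimension y <= asymptotic_dimension x)%E.
Proof.
move=> a1 gle gge; have a0 : 0 < a by lra.
rewrite !asymptotic_dimensionE; apply: le_ereal_inf_tmp => _ [r _ <-].
apply: (@le_trans _ _ (growth_exponent y (2 * a * r + b))).
  by apply: ereal_inf_lbound; exists (2 * a * r + b).
(* The term [mdist x (g y)] pays for moving the centre from [g y] to [x]. *)
apply: (@limf_esup_lne_affine _ _ _ a (b + mdist x (g y))) => // rho.
  exact: covering_number_ge1.
rewrite covering_number_ge0; apply: (@covering_number_preimage _ _ _ g) => // z.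
rewrite /= !ballEmdist/= => yz.
have := metric_triangle x (g y) (g z); have := gle y z.
have : a * mdist y z < a * rho by rewrite ltr_pM2l.
lra.
Qed.

Theorem proposition3p15 (R : realType) (X Y : metricType R) (f : X -> Y)
    (hf : rough_isometry f) (x : X) (y : Y) :
  asymptotic_dimension x = asymptotic_dimension y.
Proof.
have [a [b [e [a1 b0 e0 fab fY]]]] := hf.
have a0 : 0 < a by lra.
have fge x1 x2 : mdist x1 x2 <= a * mdist (f x1) (f x2) + a * b.
  have /andP[+ _] := fab x1 x2.
  by rewrite lerBlDr -(ler_pM2l a0) mulVKf ?gt_eqF// mulrDr.
have bab : b <= a * b by rewrite ler_peMl.
have ae : 2 * e <= a * (2 * e) by rewrite ler_peMl// mulr_ge0.
apply/eqP; rewrite eq_le; apply/andP; split.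
  apply: (@asymptotic_dimension_le _ _ _ f a (a * b)) => // x1 x2.
  by have /andP[_ /le_trans] := fab x1 x2; apply; rewrite lerD2l.
(* A quasi-inverse of [f]: [f (g z)] is within [e] of [z]. *)
have /choice[g gf] z : exists x', mdist (f x') z < e.
  have : (\bigcup_(x in [set: X]) ball (f x) e) z by rewrite fY.
  by move=> [x' _]; rewrite ballEmdist/=; exists x'.
(* Replacing [y1] and [y2] by [f (g y1)] and [f (g y2)] costs [2 * e]; the factors [a] make one
   constant serve both bounds. *)
apply: (@asymptotic_dimension_le _ _ _ g a (a * b + a * (2 * e))) => // y1 y2.
  apply: (le_trans (fge _ _)).
  have : mdist (f (g y1)) (f (g y2)) <= mdist y1 y2 + 2 * e.
    have := metric_triangle (f (g y1)) y1 (f (g y2)).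
    have := metric_triangle y1 y2 (f (g y2)).
    have := gf y1; have := gf y2; rewrite (metric_sym y2 (f _)); lra.
  rewrite -(ler_pM2l a0); lra.
have := metric_triangle y1 (f (g y1)) y2.
have := metric_triangle (f (g y1)) (f (g y2)) y2.
have /andP[_] := fab (g y1) (g y2).
have := gf y1; have := gf y2; rewrite (metric_sym y1 (f _)); lra.
Qed.
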